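(* Let $d\ge1$ and $m\ge 2$ be integers, and let $R=(R_{i_1\ldots i_{m+1}})_{1\le i_1,\ldots,i_{m+1}\le d}$ be a collection of integers satisfying the following three assumptions: (T) $R_{i_1\ldots i_{m+1}}\ge 0$ for all $1\le i_1,\ldots,i_{m+1}\le d$; (B) there exists $\sigma\in(0,\infty)$ such that $\sum_{i=1}^d R_{i i_1\ldots i_m}=\sigma$ for all $1\le i_1,\ldots,i_m\le d$; (E) $\max_{j,j'\in\{1,\ldots,d\}^m}\sum_{i=1}^d |R_{i j_1\ldots j_m}-R_{i j'_1\ldots j'_m}|<2\sigma/m$. Let $(U(n))_{n\ge 0}$ be an $m$-drawing $d$-colour Pólya urn with replacement tensor $R$ and with $\|U(0)\|_1>0$. Then there exists a unique $x^*\in\Delta_d$ satisfying $\sigma x^*=\mathcal R(x^*,\ldots,x^* )$ and, in probability as $n\to\infty$, $$\frac{U(n)}{\sum_{i=1}^d U_i(n)}\to x^*.$$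
   Context: $\Delta_d=\{x\in[0,1]^d : \|x\|_1=1\}$, where $\|x\|_1=\sum_{i=1}^d|x_i|$. The $(m+1)$-mode tensor $\mathcal R:(\mathbb R^d)^m\to\mathbb R^d$ is the multilinear map $\mathcal R=(\mathcal R_1,\ldots,\mathcal R_d)$ with $$\mathcal R_i(x^{(1)},\ldots,x^{(m)})=\sum_{1\le i_1,\ldots,i_m\le d}R_{i i_1\ldots i_m}\,x^{(1)}_{i_1}\cdots x^{(m)}_{i_m}.$$ The $m$-drawing $d$-colour Pólya urn with replacement tensor $R$ is a Markov process $(U(n)=(U_1(n),\ldots,U_d(n)))_{n\ge 0}$ on $\mathbb N^d$ (with $0\in\mathbb N$), with deterministic $U(0)$, such that for all $n\ge0$ and $1\le i\le d$, $$U_i(n+1)=U_i(n)+R_{i\,C_1(n)\ldots C_m(n)},$$ where, given $U(n)$ (and the past), $C_1(n),\ldots,C_m(n)$ are i.i.d. random variables with $\mathbb P(C_1(n)=k)=U_k(n)/\|U(n)\|_1$ for all $1\le k\le d$. *)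

(* Defs.v *)
From HB Require Import structures.
From mathcomp Require Import all_boot all_order all_algebra.
From mathcomp Require Import all_classical all_reals all_analysis.
Set Implicit Arguments.
Unset Strict Implicit.
Unset Printing Implicit Defensive.
Import Order.TTheory GRing.Theory Num.Theory.
Import numFieldNormedType.Exports.
Local Open Scope classical_set_scope.
Local Open Scope ring_scope.

Definition l1norm (K : realType) (d : nat) (x : 'rV[K]_d) : K :=
  \sum_(i < d) `|x 0 i|.

Definition simplex (K : realType) (d : nat) : set 'rV[K]_d :=
  [set x : 'rV[K]_d | (forall i, 0 <= x 0 i <= 1) /\ l1norm x = 1].

(* [Rt i j] is the entry of index (i, j_1, ..., j_m): the colour i whose count
   is updated comes first, and the finite function j lists the m drawn
   colours. *)
Definition tensor (d m : nat) := 'I_d -> {ffun 'I_m -> 'I_d} -> int.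

Definition tensor_map (K : realType) (d m : nat) (Rt : tensor d m)
    (x : 'I_m -> 'rV[K]_d) : 'rV[K]_d :=
  \row_(i < d) \sum_(j : {ffun 'I_m -> 'I_d})
    (Rt i j)%:~R * \prod_(l < m) x l 0 (j l).

Definition natrV (K : realType) (d : nat) (u : 'rV[nat]_d) : 'rV[K]_d :=
  map_mx (fun k : nat => k%:R) u.

Section Probability.
Context (K : realType) (dT : measure_display) (T : measurableType dT).
Variable P : probability T K.

(* Meaningful only when P B is nonzero. *)
Definition cond_prob (A B : set T) : K := fine (P (A `&` B)) / fine (P B).

Definition cvg_in_probability (d : nat) (X : nat -> T -> 'rV[K]_d)
    (x : 'rV[K]_d) : Prop :=
  forall eps : K, 0 < eps ->
    P [set w | eps <= l1norm (X n w - x)] @[n --> \oo] --> 0%E.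

(* The event that the trajectory of U up to time n is h 0, ..., h n. *)
Definition history (d : nat) (U : nat -> T -> 'rV[nat]_d) (n : nat)
    (h : nat -> 'rV[nat]_d) : set T :=
  [set w | forall k, (k <= n)%N -> U k w = h k].

(* C n l is the l-th colour drawn at time n.  As U is discrete, conditioning
   on its past is elementary conditioning on the trajectories of positive
   probability.  That the conditional law of the draws depends on the last
   state h n only is what makes U a Markov process. *)
Record urn_with_draws (d m : nat) (Rt : tensor d m) (u0 : 'rV[nat]_d)
    (U : nat -> T -> 'rV[nat]_d) (C : nat -> 'I_m -> T -> 'I_d) : Prop :=
  UrnWithDraws {
    urn_state_measurable : forall n u, measurable [set w | U n w = u];
    urn_draw_measurable : forall n l c, measurable [set w | C n l w = c];
    urn_init : forall w, U 0%N w = u0;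
    urn_step : forall n w i,
      (U n.+1 w 0 i)%:Z = (U n w 0 i)%:Z + Rt i [ffun l => C n l w];
    urn_draw_law : forall n h, P (history U n h) != 0%E ->
      forall l c, cond_prob [set w | C n l w = c] (history U n h) =
                  (h n 0 c)%:R / l1norm (natrV K (h n));
    urn_draw_indep : forall n h, P (history U n h) != 0%E ->
      forall c : 'I_m -> 'I_d,
        cond_prob [set w | forall l, C n l w = c l] (history U n h) =
        \prod_(l < m) cond_prob [set w | C n l w = c l] (history U n h)
  }.

Definition polya_urn (d m : nat) (Rt : tensor d m) (u0 : 'rV[nat]_d)
    (U : nat -> T -> 'rV[nat]_d) : Prop :=
  exists C, urn_with_draws Rt u0 U C.

End Probability.

(* Main.v *)
Require Import Defs.
From HB Require Import structures.
From mathcomp Require Import all_boot all_order all_algebra.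
From mathcomp Require Import all_classical all_reals all_analysis.
From mathcomp Require Import ring lra.
Set Implicit Arguments.
Unset Strict Implicit.
Unset Printing Implicit Defensive.
Import Order.TTheory GRing.Theory Num.Theory.
Import numFieldNormedType.Exports.
Local Open Scope classical_set_scope.
Local Open Scope ring_scope.

(** Write [H x = drift Rt x] for the mean increment of the urn at composition [x].
    Two probability vectors [x] and [y] can be coupled so that they differ with
    probability [D = l1norm (x - y) / 2] ([coupling]). Coupling the [m] draws
    independently, the two drawn words differ with probability at most
    [1 - (1 - D) ^ m <= m * D], so that [H] is Lipschitz on the simplex for the
    [l1] norm ([drift_lipschitz]), with a constant [L = delta * m / 2] where
    [delta] is the largest [l1] distance between two increments. The hypothesis
    on that distance says that [L < sigma]. Hence [x |-> H x / sigma] is a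
    contraction of the simplex and has exactly one fixed point [xs]
    ([l1_contraction_fixed]).

    The size [S n] of the urn is [S 0 + n * sigma]. With [X n] its composition
    at time [n], let [M n = U n - U 0 - sum_(k < n) H (X k)] be its martingale
    part. The increments of [M] are bounded and pairwise orthogonal, so that
    [M n / S n] tends to zero in quadratic mean, at the rate [1 / sqrt n]
    ([fexp_mart_sqr]). What remains of the deviation,
    [Z n = S n * (X n - xs) - M n], satisfies [Z (n + 1) - Z n = H (X n) - H xs]
    along each trajectory. Since [H] is [L]-Lipschitz and
    [X n - xs = (Z n + M n) / S n], the ratio [|Z n| / S n] shrinks at each step
    by the factor [1 - (sigma - L) / S (n + 1)], up to a term that
    [|M n| / S n] controls ([urn_dev_le]). The harmonic series diverges, so the
    mean of [|Z n| / S n] tends to zero ([averaging_cvg0]), and so does the mean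
    of [|X n - xs|]. Markov's inequality gives the convergence in probability
    ([prob_dist_le]).

    All expectations are finite sums: up to a given time the urn is a function
    of the words drawn so far, which are finitely many ([draws_urn_law]). The
    bounds on the means do not depend on the horizon. *)

(** * The drift is Lipschitz for the l1 norm *)

Section L1norm.
Context (K : realType) (d : nat).
Implicit Types x y : 'rV[K]_d.

Lemma l1norm_ge0 x : 0 <= l1norm x.
Proof. exact: sumr_ge0. Qed.

Lemma l1normD x y : l1norm (x + y) <= l1norm x + l1norm y.
Proof.
rewrite /l1norm -big_split /=; apply: ler_sum => i _.
by rewrite mxE ler_normD.
Qed.

Lemma l1normZ (a : K) x : l1norm (a *: x) = `|a| * l1norm x.
Proof.
by rewrite /l1norm mulr_sumr; apply: eq_bigr => i _; rewrite mxE normrM.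
Qed.

Lemma l1normN x : l1norm (- x) = l1norm x.
Proof. by apply: eq_bigr => i _; rewrite mxE normrN. Qed.

Lemma l1norm_eq0 x : l1norm x = 0 -> x = 0.
Proof.
move=> /psumr_eq0P x0; apply/rowP => i; rewrite mxE; apply/normr0_eq0.
by apply: x0.
Qed.

Lemma simplexP x :
  simplex x <-> (forall i, 0 <= x 0 i) /\ \sum_(i < d) x 0 i = 1.
Proof.
split=> [[x01 x1]|[x0 x1]].
  split=> [i|]; first by case/andP: (x01 i).
  by rewrite -x1; apply: eq_bigr => i _; rewrite ger0_norm//; case/andP: (x01 i).
split=> [i|]; last by rewrite -x1; apply: eq_bigr => i _; rewrite ger0_norm.
by rewrite x0 -x1 (bigD1 i)//= lerDl sumr_ge0.
Qed.

End L1norm.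

(** The drift of the urn: [drift Rt x] is the mean number of balls of each
    colour that are added when the [m] draws are independent with law [x]. *)
Definition drift (K : realType) (d m : nat) (Rt : tensor d m) (x : 'rV[K]_d)
  : 'rV[K]_d := tensor_map Rt (fun=> x).

Section Coupling.
Context (K : realType) (d : nat).
Implicit Types x y : 'rV[K]_d.

(** The mass that two probability vectors do not share, which is half of their
    [l1] distance. *)
Definition excess x y : K := 1 - \sum_(c < d) Num.min (x 0 c) (y 0 c).

(** A maximal coupling of two probability vectors: it keeps the common mass on
    the diagonal and couples the two remainders independently. *)
Definition coupling x y (c c' : 'I_d) : K :=
  Num.min (x 0 c) (y 0 c) *+ (c == c') +
  (x 0 c - Num.min (x 0 c) (y 0 c)) * (y 0 c' - Num.min (x 0 c') (y 0 c'))
    / excess x y.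

Lemma coupling_ge0 x y c c' : simplex x -> simplex y -> 0 <= coupling x y c c'.
Proof.
move=> /simplexP[x0 x1] /simplexP[y0 y1].
have D0 : 0 <= excess x y.
  by rewrite /excess subr_ge0 -x1 ler_sum// => i _; rewrite ge_min lexx.
apply: addr_ge0; first by rewrite mulrn_wge0// le_min x0 y0.
apply: divr_ge0 => //; apply: mulr_ge0; rewrite subr_ge0 ge_min lexx//.
by rewrite orbT.
Qed.

Lemma couplingC x y c c' : coupling x y c c' = coupling y x c' c.
Proof.
rewrite /coupling /excess eq_sym; congr (_ + _).
  by have [->|_] := eqVneq c' c; rewrite // minC.
rewrite [X in X / _]mulrC [Num.min (x 0 c) _]minC [Num.min (x 0 c') _]minC.
by congr (_ / (1 - _)); apply: eq_bigr => i _; rewrite minC.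
Qed.

Lemma coupling_suml x y c : simplex x -> simplex y ->
  \sum_(c' < d) coupling x y c c' = x 0 c.
Proof.
move=> /simplexP[x0 x1] /simplexP[y0 y1].
rewrite big_split /= -mulr_suml -mulr_sumr sumrB y1 -/(excess x y).
rewrite (bigD1 c)//= eqxx mulr1n big1 ?addr0; last first.
  by move=> i; rewrite eq_sym => /negbTE ->.
have [D0|D0] := eqVneq (excess x y) 0; last by rewrite mulfK// subrKC.
rewrite D0 mulr0 mul0r addr0; apply/eqP; rewrite eq_sym -subr_eq0; apply/eqP.
(* without excess the two vectors are equal, and division by zero is harmless *)
have /psumr_eq0P : \sum_(i < d) (x 0 i - Num.min (x 0 i) (y 0 i)) = 0.
  by rewrite sumrB x1.
by apply=> // i _; rewrite subr_ge0 ge_min lexx.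
Qed.

Lemma coupling_sumr x y c : simplex x -> simplex y ->
  \sum_(c' < d) coupling x y c' c = y 0 c.
Proof.
by move=> sx sy; under eq_bigr do rewrite couplingC; exact: coupling_suml.
Qed.

Lemma excessE x y : simplex x -> simplex y -> excess x y = l1norm (x - y) / 2.
Proof.
move=> /simplexP[x0 x1] /simplexP[y0 y1].
have -> : l1norm (x - y) =
    \sum_(i < d) (x 0 i + y 0 i - 2 * Num.min (x 0 i) (y 0 i)).
  apply: eq_bigr => i _; rewrite !mxE.
  by case: (leP (x 0 i) (y 0 i)) => xy;
    [rewrite ler0_norm|rewrite gtr0_norm]; lra.
by rewrite sumrB big_split /= x1 y1 -mulr_sumr /excess; lra.
Qed.

Lemma coupling_diag x y : simplex x -> simplex y ->
  1 - excess x y <= \sum_(c < d) coupling x y c c.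
Proof.
move=> sx sy; rewrite opprB subrKC; apply: ler_sum => c _.
rewrite /coupling eqxx mulr1n lerDl.
move: (sx) (sy) => /simplexP[x0 x1] /simplexP[y0 y1].
apply: divr_ge0; last by rewrite excessE// divr_ge0 ?l1norm_ge0.
by apply: mulr_ge0; rewrite subr_ge0 ge_min lexx// orbT.
Qed.

End Coupling.

(** Bernoulli's inequality. *)
Lemma bernoulli_le (K : realFieldType) (x : K) (n : nat) : 0 <= x <= 1 ->
  1 - x *+ n <= (1 - x) ^+ n.
Proof.
move=> /andP[x0 x1]; elim: n => [|n IHn]; first by rewrite subr0 expr0.
rewrite exprS; apply: le_trans (ler_wpM2l _ IHn); last by rewrite subr_ge0.
have : 0 <= x * (x *+ n) by rewrite mulr_ge0 ?mulrn_wge0.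
by rewrite mulrSr => xn; lra.
Qed.

Section Drift.
Context (K : realType) (d m : nat) (Rt : tensor d m) (sigma M : K).
Hypothesis Rt_ge0 : forall i j, 0 <= Rt i j.
Hypothesis Rt_sum : forall j, \sum_(i < d) ((Rt i j)%:~R : K) = sigma.
Hypothesis Rt_diam : forall j j',
  \sum_(i < d) `|((Rt i j)%:~R : K) - (Rt i j')%:~R| <= M.
Implicit Types x y : 'rV[K]_d.

Lemma sum_prod_simplex x : simplex x ->
  \sum_(j : {ffun 'I_m -> 'I_d}) \prod_(l < m) x 0 (j l) = 1.
Proof.
move=> /simplexP[_ x1].
by rewrite -(bigA_distr_bigA (fun=> x 0)) /= big1.
Qed.

Lemma drift_ge0 x i : simplex x -> 0 <= drift Rt x 0 i.
Proof.
move=> /simplexP[x0 _]; rewrite mxE; apply: sumr_ge0 => j _.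
by rewrite mulr_ge0 ?ler0z// prodr_ge0.
Qed.

Lemma drift_sum x : simplex x -> \sum_(i < d) drift Rt x 0 i = sigma.
Proof.
move=> sx; under eq_bigr do rewrite mxE.
rewrite exchange_big /=; under eq_bigr do rewrite -mulr_suml Rt_sum.
by rewrite -mulr_sumr sum_prod_simplex// mulr1.
Qed.

Lemma drift_lipschitz x y : simplex x -> simplex y ->
  l1norm (drift Rt x - drift Rt y) <= M * m%:R / 2 * l1norm (x - y).
Proof.
move=> sx sy.
pose J := {ffun 'I_m -> 'I_d}.
pose g (j j' : J) : K := \prod_(l < m) coupling x y (j l) (j' l).
have g0 j j' : 0 <= g j j' by apply: prodr_ge0 => l _; exact: coupling_ge0.
have gl j : \sum_j' g j j' = \prod_(l < m) x 0 (j l).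
  rewrite -(bigA_distr_bigA (fun l c => coupling x y (j l) c)) /=.
  by apply: eq_bigr => l _; exact: coupling_suml.
have gr j' : \sum_j g j j' = \prod_(l < m) y 0 (j' l).
  rewrite -(bigA_distr_bigA (fun l c => coupling x y c (j' l))) /=.
  by apply: eq_bigr => l _; exact: coupling_sumr.
have M0 : 0 <= M.
  have [j|J0] := pickP (@predT J).
    by move=> _; apply: le_trans (Rt_diam j j); exact: sumr_ge0.
  have := sum_prod_simplex sx; rewrite big1 => [/eqP|j]; last by have := J0 j.
  by rewrite eq_sym oner_eq0.
have dE i : drift Rt x 0 i - drift Rt y 0 i =
    \sum_j \sum_j' g j j' * ((Rt i j)%:~R - (Rt i j')%:~R).
  under [RHS]eq_bigr do (under eq_bigr do rewrite mulrBr; rewrite sumrB).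
  rewrite sumrB; congr (_ - _); rewrite !mxE.
    by apply: eq_bigr => j _; rewrite -mulr_suml gl mulrC.
  rewrite [RHS]exchange_big; apply: eq_bigr => j _.
  by rewrite /= -mulr_suml gr mulrC.
have le1 : l1norm (drift Rt x - drift Rt y) <=
    \sum_j \sum_j' g j j' * (M *+ (j != j')).
  apply: (@le_trans _ _ (\sum_(i < d) \sum_j \sum_j'
     g j j' * `|((Rt i j)%:~R : K) - (Rt i j')%:~R|)).
    apply: ler_sum => i _; rewrite !mxE -!/(drift _ _ 0 i).
    have := dE i; rewrite !mxE => ->.
    apply: (le_trans (ler_norm_sum _ _ _)); apply: ler_sum => j _.
    apply: (le_trans (ler_norm_sum _ _ _)); apply: ler_sum => j' _.
    by rewrite normrM ger0_norm.
  rewrite exchange_big; apply: ler_sum => j _.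
  rewrite exchange_big; apply: ler_sum => j' _ /=.
  rewrite -mulr_sumr; apply: ler_wpM2l => //.
  have [->|_] := eqVneq j j'; last by rewrite Rt_diam.
  by rewrite big1// => i _; rewrite subrr normr0.
have diag : \sum_j g j j = (\sum_(c < d) coupling x y c c) ^+ m.
  rewrite /g -(bigA_distr_bigA (fun _ c => coupling x y c c)) /=.
  by rewrite big_const_ord iter_mulr_1.
have offdiag : \sum_j \sum_j' g j j' * (M *+ (j != j')) =
    M * (1 - \sum_j g j j).
  rewrite -(sum_prod_simplex sx) -sumrB mulr_sumr; apply: eq_bigr => j _.
  rewrite -gl [in RHS](bigD1 j)//= addrAC subrr add0r mulr_sumr.
  rewrite (bigD1 j)//= eqxx mulr0n mulr0 add0r; apply: eq_bigr => j'.
  by rewrite eq_sym => /negbTE ->; rewrite mulr1n mulrC.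
apply: (le_trans le1); rewrite offdiag -!mulrA; apply: ler_wpM2l => //.
have E := excessE sx sy.
have e01 : 0 <= excess x y <= 1.
  rewrite {1}E divr_ge0 ?l1norm_ge0//= /excess gerBl sumr_ge0// => i _.
  by move: sx sy => /simplexP[x0 _] /simplexP[y0 _]; rewrite le_min x0 y0.
rewrite [_^-1 * _]mulrC -E mulr_natl.
have := bernoulli_le m e01; rewrite diag => B.
rewrite lerBlDr addrC -lerBlDr; apply: (le_trans B).
apply: lerXn2r; last exact: coupling_diag.
  by rewrite nnegrE subr_ge0; case/andP: e01.
by rewrite nnegrE sumr_ge0// => c _; exact: coupling_ge0.
Qed.

End Drift.

(** * Averaging with non-summable steps *)

Section Sequences.
Context (K : realType).
Implicit Types (u a c e : nat -> K).

Lemma prodr_ge_sum a n : (forall k, 0 <= a k) ->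
  1 + \sum_(k < n) a k <= \prod_(k < n) (1 + a k).
Proof.
move=> a0; elim: n => [|n IHn]; first by rewrite !big_ord0 addr0.
rewrite !big_ord_recr /=.
apply: le_trans (ler_wpM2r _ IHn); last by rewrite addr_ge0.
have : 0 <= (\sum_(k < n) a k) * a n by rewrite mulr_ge0// sumr_ge0.
by move=> sa; lra.
Qed.

Lemma prodrB_le c n (A : K) : (forall k, 0 <= c k <= 1) -> 0 < A ->
  A <= \sum_(k < n) c k -> \prod_(k < n) (1 - c k) <= A^-1.
Proof.
move=> c01 A0 An.
have c0 k : 0 <= c k by case/andP: (c01 k).
have p0 : 0 <= \prod_(k < n) (1 - c k).
  by rewrite prodr_ge0// => k _; rewrite subr_ge0; case/andP: (c01 k).
have le1 : (\prod_(k < n) (1 - c k)) * (\prod_(k < n) (1 + c k)) <= 1.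
  rewrite -big_split /=; apply: prodr_ile1 => k _.
  have := c0 k; case/andP: (c01 k) => _ ck1 ck0.
  have ck2 : 0 <= c k * c k by rewrite mulr_ge0.
  have ck3 : c k * c k <= 1 by rewrite mulr_ile1.
  by apply/andP; split; lra.
have le2 : A <= \prod_(k < n) (1 + c k).
  by apply: le_trans (prodr_ge_sum _ c0); apply: (le_trans An); rewrite lerDr.
rewrite -[leRHS]div1r ler_pdivlMr//.
by apply: le_trans le1; exact: ler_wpM2l.
Qed.

(** Averaging lemma: a sequence that moves towards [e n] by a proportion [c n]
    at each step has the limit zero as soon as [e] has, provided that the
    proportions are not summable. *)
Lemma averaging_cvg0 u c e :
  (forall n, 0 <= c n <= 1) -> (forall A, exists n, A <= \sum_(k < n) c k) ->
  (forall n, 0 <= u n) -> (forall n, u n.+1 <= (1 - c n) * u n + c n * e n) ->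
  e @ \oo --> (0 : K) -> u @ \oo --> (0 : K).
Proof.
move=> c01 dc u0 uS e0.
apply/cvgrPdist_le => eps eps0.
have eps2 : 0 < eps / 2 by rewrite divr_gt0.
have /cvgrPdist_le/(_ _ eps2)[N _ eN] := e0.
have {}eN n : (N <= n)%N -> e n <= eps / 2.
  by move=> /eN /=; rewrite sub0r normrN => /ler_normlW.
have uN n : u (n + N)%N <=
    eps / 2 + (\prod_(k < n) (1 - c (k + N)%N)) * u N.
  elim: n => [|n IHn]; first by rewrite big_ord0 mul1r lerDr ltW.
  rewrite addSn; apply: (le_trans (uS _)).
  case/andP: (c01 (n + N)%N) => c0 c1.
  have l1 := ler_wpM2l c0 (eN _ (leq_addl n N)).
  have l2 : 0 <= 1 - c (n + N)%N by rewrite subr_ge0.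
  have {}l2 := ler_wpM2l l2 IHn.
  rewrite big_ord_recr /=.
  set p := \prod_(i < n) _ in l2 *.
  have -> : p * (1 - c (n + N)%N) * u N = (1 - c (n + N)%N) * (p * u N) by ring.
  by move: l1 l2; rewrite mulrDr; lra.
pose A := (u N + 1) / (eps / 2).
have A0 : 0 < A by rewrite divr_gt0// ltr_wpDl.
have [n hn] := dc (A + \sum_(k < N) c k).
exists (n + N)%N => // k /= nk.
have Nk : (N <= k)%N by apply: leq_trans nk; rewrite leq_addl.
rewrite sub0r normrN ger0_norm// -(subnK Nk).
apply: (le_trans (uN _)); rewrite [leRHS]splitr lerD2l.
have c01' i : 0 <= c (i + N)%N <= 1 by [].
apply: (@le_trans _ _ (A^-1 * u N)).
  apply: ler_wpM2r => //; apply: (@prodrB_le (fun i => c (i + N)%N)) => //.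
  rewrite -(lerD2r (\sum_(k < N) c k)); apply: (le_trans hn).
  have c0 i : 0 <= c i by case/andP: (c01 i).
  rewrite addrC.
  have -> : \sum_(k < N) c k + \sum_(i < k - N) c (i + N)%N = \sum_(i < k) c i.
    rewrite -[in RHS](subnKC Nk) big_split_ord /=; congr (_ + _).
    by apply: eq_bigr => i _; rewrite addnC.
  have {}nk : (n <= k)%N by apply: leq_trans nk; rewrite leq_addr.
  rewrite -(subnKC nk) big_split_ord /= lerDl.
  by rewrite sumr_ge0.
rewrite /A invf_div mulrAC ler_pdivrMr ?ltr_wpDl// ler_wpM2l ?ltW//.
by rewrite ltrDl.
Qed.

Lemma arithmetic_inv_unbounded (s sigma kappa : K) :
  0 < s -> 0 < sigma -> 0 < kappa ->
  forall A, exists n, A <= \sum_(k < n) kappa / (s + sigma *+ k.+1).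
Proof.
move=> s0 sg0 k0 A.
have h0 : 0 < kappa / (s + sigma) by rewrite divr_gt0// addr_gt0.
have /cvgryPge/(_ (A / (kappa / (s + sigma))))[n _ /(_ n)/= hn] :=
  nondecreasing_dvgn_lt
    (nondecreasing_series (fun k _ _ => @harmonic_ge0 K k)) (@dvg_harmonic K).
have := hn (leqnn n); rewrite ler_pdivrMr// => {}hn; exists n.
apply: (le_trans hn); rewrite big_mkord mulr_suml; apply: ler_sum => k _.
rewrite mulrCA ler_wpM2l ?(ltW k0)// -invfM lef_pV2 ?posrE.
- rewrite mulrDr !mulr_natl lerD// -[leRHS]mulr_natl ler_peMl ?(ltW s0)//.
  by rewrite ler1n.
- by rewrite mulr_gt0// addr_gt0.
- by rewrite addr_gt0// pmulrn_rgt0.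
Qed.

End Sequences.

(** * Fixed points of l1 contractions of the simplex *)

Section FixedPoint.
Context (K : realType) (d : nat) (F : 'rV[K]_d -> 'rV[K]_d) (q : K).
Hypothesis q_ge0 : 0 <= q.
Hypothesis q_lt1 : q < 1.
Hypothesis F_simplex : forall x, simplex x -> simplex (F x).
Hypothesis F_contract : forall x y, simplex x -> simplex y ->
  l1norm (F x - F y) <= q * l1norm (x - y).

Lemma l1_contraction_fixed_unique x y :
  simplex x -> simplex y -> F x = x -> F y = y -> x = y.
Proof.
move=> sx sy Fx Fy; apply/eqP; rewrite -subr_eq0; apply/eqP/l1norm_eq0.
have := F_contract sx sy; rewrite Fx Fy => h.
have n0 := l1norm_ge0 (x - y); apply/eqP; rewrite eq_le n0 andbT.
have : (1 - q) * l1norm (x - y) <= 0 by rewrite mulrBl mul1r subr_le0.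
by rewrite pmulr_rle0// subr_gt0.
Qed.

(** The contraction principle in the [l1] norm: the iterates converge
    coordinatewise by comparison with a geometric series. *)
Lemma l1_contraction_fixed (x0 : 'rV[K]_d) : simplex x0 ->
  exists2 x : 'rV[K]_d, simplex x & F x = x.
Proof.
move=> sx0.
pose x n := iter n F x0.
have sx n : simplex (x n) by elim: n => //= n; exact: F_simplex.
have xS n : l1norm (x n.+1 - x n) <= geometric (l1norm (x 1%N - x 0%N)) q n.
  elim: n => [|n IHn]; first by rewrite /= expr0 mulr1.
  rewrite [geometric _ _ _]/= exprS mulrCA.
  apply: (le_trans (F_contract (sx n.+1) (sx n))).
  exact: ler_wpM2l.
have cvg_x i : cvgn (fun n => x n 0 i).
  have -> : (fun n => x n 0 i) =
      (fun n => x 0%N 0 i + series (telescope (fun n => x n 0 i)) n).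
    by apply/funext => n; rewrite telescopeK /= subrKC.
  apply: is_cvgD; first exact: is_cvg_cst.
  apply: normed_cvg; apply: series_le_cvg.
  - by move=> n; exact: normr_ge0.
  - by move=> n; exact: (le_trans (l1norm_ge0 _) (xS n)).
  - move=> n; apply: le_trans (xS n); rewrite /telescope /l1norm.
    by rewrite (bigD1 i)//= !mxE lerDl sumr_ge0.
  - by apply: is_cvg_geometric_series; rewrite ger0_norm.
pose xs : 'rV[K]_d := \row_i limn (fun n => x n 0 i).
have xsP i : x n 0 i @[n --> \oo] --> xs 0 i by rewrite mxE; exact: cvg_x.
have sxs : simplex xs.
  apply/simplexP; split=> [i|].
    apply: (cvgr_to_ge (xsP i)); apply: nearW => n.
    by case/simplexP: (sx n).
  have sum1 : (fun n => \sum_(i < d) x n 0 i) = cst 1.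
    by apply/funext => n; case/simplexP: (sx n).
  have : \sum_(i < d) x n 0 i @[n --> \oo] --> \sum_(i < d) xs 0 i.
    by apply: cvg_big => [|i _]; [exact: add_continuous|exact: xsP].
  by rewrite sum1 => h; apply: (cvg_unique _ h (@cvg_cst _ _ _ _ _)).
have dist0 : l1norm (x n - xs) @[n --> \oo] --> (0 : K).
  have -> : (0 : K) = \sum_(i < d) 0 by rewrite big1.
  apply: cvg_big => [|i _]; first exact: add_continuous.
  rewrite -(normr0 K); apply: cvg_norm; rewrite -(subrr (xs 0 i)).
  have -> : (fun n => (x n - xs) 0 i) = (fun n => x n 0 i - xs 0 i).
    by apply/funext => n; rewrite !mxE.
  by apply: cvgB; [exact: xsP|exact: cvg_cst].
exists xs => //; apply/eqP; rewrite -subr_eq0; apply/eqP/l1norm_eq0.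
apply/eqP; rewrite eq_le l1norm_ge0 andbT.
have : q * l1norm (x n - xs) + l1norm (x n.+1 - xs) @[n --> \oo] --> (0 : K).
  rewrite -(addr0 0) -[X in X + _](mulr0 q); apply: cvgD.
    by apply: cvgM => //; exact: cvg_cst.
  by rewrite (cvg_shiftS (fun n => l1norm (x n - xs))).
move=> /cvgr_to_ge; apply; apply: nearW => n.
have -> : F xs - xs = (F xs - x n.+1) + (x n.+1 - xs) by rewrite subrKA.
apply: (le_trans (l1normD _ _)); rewrite lerD2r -l1normN opprB /=.
exact: F_contract.
Qed.

End FixedPoint.

(** * Trajectories of the urn *)

(** The urn as a function of the words drawn at times [0, 1, ...]. *)
Fixpoint urn_path (d m : nat) (Rt : tensor d m) (u0 : 'rV[nat]_d)
    (c : nat -> {ffun 'I_m -> 'I_d}) (n : nat) : 'rV[nat]_d :=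
  if n is k.+1 then \row_i (urn_path Rt u0 c k 0%R i + `|Rt i (c k)|)%N else u0.

Lemma urn_pathS (d m : nat) (Rt : tensor d m) u0 c n i :
  urn_path Rt u0 c n.+1 0 i = (urn_path Rt u0 c n 0%R i + `|Rt i (c n)|)%N.
Proof. by rewrite mxE. Qed.

(** The composition of an urn, as a probability vector. *)
Definition urn_frac (K : realType) (d : nat) (u : 'rV[nat]_d) : 'rV[K]_d :=
  (\sum_(i < d) (u 0 i)%:R)^-1 *: natrV K u.

(** The martingale part of the urn along the words [c]. *)
Definition urn_mart (K : realType) (d m : nat) (Rt : tensor d m)
    (u0 : 'rV[nat]_d) (c : nat -> {ffun 'I_m -> 'I_d}) (n : nat) : 'rV[K]_d :=
  natrV K (urn_path Rt u0 c n) - natrV K u0 -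
  \sum_(k < n) drift Rt (urn_frac K (urn_path Rt u0 c k)).

Section UrnPath.
Context (K : realType) (d m : nat) (Rt : tensor d m) (sigma L : K)
  (u0 : 'rV[nat]_d).
Hypothesis Rt_ge0 : forall i j, 0 <= Rt i j.
Hypothesis Rt_sum : forall j, \sum_(i < d) ((Rt i j)%:~R : K) = sigma.
Hypothesis sigma_gt0 : 0 < sigma.
Hypothesis u0_gt0 : 0 < l1norm (natrV K u0).
Implicit Types (c : nat -> {ffun 'I_m -> 'I_d}).

Local Notation path c n := (urn_path Rt u0 c n).
Local Notation X c n := (urn_frac K (urn_path Rt u0 c n)).

(** The total number of balls at time [n]. *)
Definition urn_size (n : nat) : K := l1norm (natrV K u0) + sigma *+ n.

Lemma urn_size_gt0 n : 0 < urn_size n.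
Proof. by rewrite ltr_pwDl// mulrn_wge0// ltW. Qed.

Lemma urn_sizeS n : urn_size n.+1 = urn_size n + sigma.
Proof. by rewrite /urn_size mulrSr addrA. Qed.

Lemma natrVE (u : 'rV[nat]_d) i : natrV K u 0 i = (u 0 i)%:R.
Proof. by rewrite mxE. Qed.

Lemma natrVS c n i :
  natrV K (path c n.+1) 0 i = natrV K (path c n) 0 i + (Rt i (c n))%:~R.
Proof.
rewrite !natrVE urn_pathS natrD; congr (_ + _).
by rewrite -[in RHS](gez0_abs (Rt_ge0 _ _)).
Qed.

Lemma l1norm_natrV (u : 'rV[nat]_d) :
  l1norm (natrV K u) = \sum_(i < d) (u 0 i)%:R.
Proof. by apply: eq_bigr => i _; rewrite mxE normr_nat. Qed.

Lemma urn_path_size c n : \sum_(i < d) (path c n 0 i)%:R = urn_size n.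
Proof.
elim: n => [|n IHn]; first by rewrite /urn_size addr0 l1norm_natrV.
rewrite urn_sizeS -IHn -(Rt_sum (c n)) -big_split /=; apply: eq_bigr => i _.
by rewrite -!natrVE natrVS.
Qed.

Lemma urn_fracE c n : natrV K (path c n) = urn_size n *: X c n.
Proof.
by rewrite /urn_frac urn_path_size scalerA divff ?scale1r// gt_eqF// urn_size_gt0.
Qed.

Lemma urn_frac_simplex c n : simplex (X c n).
Proof.
apply/simplexP; split=> [i|].
  rewrite mxE natrVE mulr_ge0// urn_path_size invr_ge0 ltW// urn_size_gt0//.
under eq_bigr do rewrite mxE natrVE.
by rewrite -mulr_sumr urn_path_size mulVf// gt_eqF// urn_size_gt0.
Qed.

Lemma urn_martS c n i : urn_mart K Rt u0 c n.+1 0 i =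
  urn_mart K Rt u0 c n 0 i + ((Rt i (c n))%:~R - drift Rt (X c n) 0 i).
Proof.
rewrite /urn_mart big_ord_recr /= opprD addrA.
have := natrVS c n i.
rewrite [(_ - drift _ _) _ _]mxE [(- drift _ _) _ _]mxE.
set D := drift _ _; set S := \sum_(k < n) _.
move: (natrV K _) => /= v; rewrite ![(_ - S) _ _]mxE ![(_ - natrV K u0) _ _]mxE => ->.
by ring.
Qed.

(** Both terms of an increment of the martingale part lie in [[0, sigma]]. *)
Lemma urn_mart_step_le c n i :
  ((Rt i (c n))%:~R - drift Rt (X c n) 0 i) ^+ 2 <= sigma ^+ 2.
Proof.
have r0 k : 0 <= (Rt k (c n))%:~R :> K by rewrite ler0z.
have sX := urn_frac_simplex c n.
have d0 k := drift_ge0 Rt_ge0 k sX.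
have r1 : (Rt i (c n))%:~R <= sigma.
  by rewrite -(Rt_sum (c n)) (bigD1 i)//= lerDl sumr_ge0.
have d1 : drift Rt (X c n) 0 i <= sigma.
  by rewrite -(drift_sum Rt_sum sX) (bigD1 i)//= lerDl sumr_ge0.
rewrite -real_normK ?num_real// lerXn2r ?nnegrE ?(ltW sigma_gt0)//.
by rewrite ler_norml; have := r0 i; have := d0 i; lra.
Qed.

Section Distance.
Context (xs : 'rV[K]_d).
Hypothesis xs_simplex : simplex xs.
Hypothesis xs_fixed : drift Rt xs = sigma *: xs.
Hypothesis L_lt : L < sigma.
Hypothesis L_ge0 : 0 <= L.
Hypothesis drift_lip : forall x y, simplex x -> simplex y ->
  l1norm (drift Rt x - drift Rt y) <= L * l1norm (x - y).

(** Once its martingale part is removed, the deviation of the urn from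
    [urn_size n *: xs] moves only by differences of the drift. *)
Definition urn_dev c n : 'rV[K]_d :=
  urn_size n *: (X c n - xs) - urn_mart K Rt u0 c n.

Lemma urn_devS c n :
  urn_dev c n.+1 = urn_dev c n + (drift Rt (X c n) - drift Rt xs).
Proof.
rewrite /urn_dev !scalerBr -!urn_fracE xs_fixed urn_sizeS scalerDl.
rewrite /urn_mart big_ord_recr /=.
set S := \sum_(k < n) _; set D := drift _ _.
apply/rowP => i; rewrite !mxE; ring.
Qed.

Lemma urn_frac_dist c n : l1norm (X c n - xs) <=
  l1norm (urn_dev c n) / urn_size n +
  l1norm (urn_mart K Rt u0 c n) / urn_size n.
Proof.
have S0 := urn_size_gt0 n.
rewrite -mulrDl ler_pdivlMr// mulrC -{1}(gtr0_norm S0) -l1normZ.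
by rewrite -[Y in l1norm Y](subrK (urn_mart K Rt u0 c n)) l1normD.
Qed.

Lemma urn_dev_le c n : l1norm (urn_dev c n.+1) / urn_size n.+1 <=
  (1 - (sigma - L) / urn_size n.+1) * (l1norm (urn_dev c n) / urn_size n) +
  (sigma - L) / urn_size n.+1 *
    (L / (sigma - L) * (l1norm (urn_mart K Rt u0 c n) / urn_size n)).
Proof.
have S0 := urn_size_gt0 n; have S1 := urn_size_gt0 n.+1.
have H : l1norm (urn_dev c n.+1) <= l1norm (urn_dev c n) +
    L * (l1norm (urn_dev c n) / urn_size n +
         l1norm (urn_mart K Rt u0 c n) / urn_size n).
  rewrite urn_devS; apply: (le_trans (l1normD _ _)); rewrite lerD2l.
  apply: (le_trans (drift_lip (urn_frac_simplex _ _) xs_simplex)).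
  by rewrite ler_wpM2l// urn_frac_dist.
rewrite ler_pdivrMr//; apply: (le_trans H).
rewrite le_eqVlt; apply/orP; left; apply/eqP.
move: S0 S1; rewrite urn_sizeS; move: (urn_size n) => S S0 S1.
have sL : sigma - L != 0 by rewrite subr_eq0 gt_eqF.
have S0' : S != 0 by rewrite gt_eqF.
have S1' : S + sigma != 0 by rewrite gt_eqF.
by field; rewrite S1' sL S0'.
Qed.

End Distance.

End UrnPath.

(** * Expectations under the joint law of the draws *)

Section FiniteLaw.
Context (K : realType) (d m : nat) (Rt : tensor d m) (sigma : K)
  (u0 : 'rV[nat]_d).
Hypothesis Rt_ge0 : forall i j, 0 <= Rt i j.
Hypothesis Rt_sum : forall j, \sum_(i < d) ((Rt i j)%:~R : K) = sigma.
Hypothesis sigma_gt0 : 0 < sigma.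
Hypothesis u0_gt0 : 0 < l1norm (natrV K u0).
Context (N : nat).

Local Notation J := {ffun 'I_m -> 'I_d}.
Local Notation Om := {ffun 'I_N.+1 -> J}.

(** The infinite sequence of words that a finite one stands for; only its
    values up to time [N] matter. *)
Definition word (s : Om) (k : nat) : J := s (inord k).

(** [s] and [s'] give the same trajectory of the urn up to time [n]. *)
Definition same_history (n : nat) (s s' : Om) : bool :=
  [forall k : 'I_n.+1, urn_path Rt u0 (word s') k == urn_path Rt u0 (word s) k].

Lemma same_historyP n s s' : reflect
  (forall k, (k <= n)%N ->
     urn_path Rt u0 (word s') k = urn_path Rt u0 (word s) k)
  (same_history n s s').
Proof.
apply: (iffP forallP) => h k; last by apply/eqP; apply: h; rewrite -ltnS.
by rewrite -ltnS => kn; exact: (eqP (h (Ordinal kn))).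
Qed.

(** [p] is the joint law of the words drawn at times [0, ..., N]: given the
    trajectory of the urn, the draws of a word are independent with law the
    current composition. Given a whole trajectory, and not the past words, is
    what the definition of the urn provides. *)
Record urn_law (p : Om -> K) : Prop := UrnLaw {
  urn_law_ge0 : forall s, 0 <= p s;
  urn_law_sum : \sum_s p s = 1;
  urn_law_draw : forall n s (j : J), (n <= N)%N ->
    \sum_(s' | same_history n s s' && (word s' n == j)) p s' =
    (\sum_(s' | same_history n s s') p s') *
    \prod_(l < m) urn_frac K (urn_path Rt u0 (word s) n) 0 (j l)
}.

Context (p : Om -> K).
Hypothesis p_law : urn_law p.

(** The expectation of [f] under the law [p]. *)
Definition fexp (f : Om -> K) : K := \sum_s p s * f s.

Lemma fexpD f g : fexp (fun s => f s + g s) = fexp f + fexp g.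
Proof. by rewrite /fexp -big_split; apply: eq_bigr => s _; rewrite mulrDr. Qed.

Lemma fexpZ (a : K) f : fexp (fun s => a * f s) = a * fexp f.
Proof. by rewrite /fexp mulr_sumr; apply: eq_bigr => s _; rewrite mulrCA. Qed.

Lemma fexp_cst (a : K) : fexp (fun=> a) = a.
Proof. by rewrite /fexp -mulr_suml (urn_law_sum p_law) mul1r. Qed.

Lemma ler_fexp f g : (forall s, f s <= g s) -> fexp f <= fexp g.
Proof.
by move=> fg; apply: ler_sum => s _; rewrite ler_wpM2l// (urn_law_ge0 p_law).
Qed.

Lemma fexp_sum (I : finType) (f : I -> Om -> K) :
  fexp (fun s => \sum_i f i s) = \sum_i fexp (f i).
Proof.
by rewrite /fexp exchange_big; apply: eq_bigr => s _; rewrite mulr_sumr.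
Qed.

(** The variance of [|f|] is nonnegative. *)
Lemma sqr_fexp_norm f :
  (fexp (fun s => `|f s|)) ^+ 2 <= fexp (fun s => f s ^+ 2).
Proof.
set mu := fexp _.
have h0 : 0 <= fexp (fun s => (`|f s| - mu) ^+ 2).
  by apply: sumr_ge0 => s _; rewrite mulr_ge0 ?sqr_ge0// (urn_law_ge0 p_law).
have hE : fexp (fun s => (`|f s| - mu) ^+ 2) = fexp (fun s => f s ^+ 2) - mu ^+ 2.
  have -> : (fun s => (`|f s| - mu) ^+ 2) =
      (fun s => f s ^+ 2 + (- (2 * mu) * `|f s| + mu ^+ 2)).
    by apply/funext => s; rewrite -(real_normK (num_real (f s))); ring.
  by rewrite fexpD fexpD fexpZ fexp_cst -/mu; ring.
by move: h0; rewrite hE subr_ge0.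
Qed.

(** Functions of the trajectory up to time [n] only see the conditional mean of
    the [n]-th increment. The proof sums over the classes of [same_history]. *)
Lemma fexp_cond n (g : Om -> K) i : (n <= N)%N ->
  (forall s s', same_history n s s' -> g s' = g s) ->
  fexp (fun s => g s * (Rt i (word s n))%:~R) =
  fexp (fun s => g s * drift Rt (urn_frac K (urn_path Rt u0 (word s) n)) 0 i).
Proof.
move=> nN gh.
pose cls s : {set Om} := [set s' | same_history n s s']%SET.
have clsE s s' : (cls s' == cls s) = same_history n s s'.
  apply/eqP/idP => [e|/same_historyP h].
    have : s' \in cls s' by rewrite inE; apply/same_historyP.
    by rewrite e inE.
  apply/finset.setP => s2; rewrite !inE; apply/same_historyP/same_historyP => h2 k kn.
    by rewrite h2// h.
  by rewrite h2// h.
rewrite /fexp !(partition_big cls predT)//=; apply: eq_bigr => A _.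
have [s /eqP sA|A0] := pickP (fun s => cls s == A); last first.
  by rewrite !big_pred0.
rewrite -sA; under eq_bigl do rewrite clsE; under [RHS]eq_bigl do rewrite clsE.
under eq_bigr => s' ss' do rewrite (gh _ _ ss').
under [RHS]eq_bigr => s' ss' do
  rewrite (gh _ _ ss') ((same_historyP _ _ _ ss') n (leqnn n)).
rewrite -mulr_suml /= [LHS](partition_big (fun s' => word s' n) predT)//=.
rewrite mulrCA [drift _ _ _ _]mxE !mulr_sumr; apply: eq_bigr => j _.
rewrite [X in _ = _ * X]mulrCA -(urn_law_draw p_law _ _ nN) !mulr_sumr.
by apply: eq_bigr => s' /andP[_ /eqP ->]; ring.
Qed.

Lemma urn_mart_history n s s' i : same_history n s s' ->
  urn_mart K Rt u0 (word s') n 0 i = urn_mart K Rt u0 (word s) n 0 i.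
Proof.
move=> /same_historyP h; rewrite /urn_mart (h n)//; congr (fun_of_matrix (_ - _) 0 i).
by apply: eq_bigr => k _; rewrite (h k)// ltnW.
Qed.

Lemma fexp_mart_sqr n i : (n <= N.+1)%N ->
  fexp (fun s => urn_mart K Rt u0 (word s) n 0 i ^+ 2) <= sigma ^+ 2 *+ n.
Proof.
elim: n => [_|n IHn nN].
  rewrite -[leRHS]fexp_cst; apply: ler_fexp => s.
  by rewrite /urn_mart big_ord0 /= subr0 subrr mxE expr0n.
pose M s := urn_mart K Rt u0 (word s) n 0 i.
pose xi s := (Rt i (word s n))%:~R -
  drift Rt (urn_frac K (urn_path Rt u0 (word s) n)) 0 i.
have -> : (fun s => urn_mart K Rt u0 (word s) n.+1 0 i ^+ 2) =
    (fun s => M s ^+ 2 + (2 * (M s * xi s) + xi s ^+ 2)).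
  by apply/funext => s; rewrite urn_martS// -/(M s) -/(xi s); ring.
(* the cross term vanishes: the increments are orthogonal to the past *)
have Mxi : fexp (fun s => M s * xi s) = 0.
  have -> : (fun s => M s * xi s) = (fun s => M s * (Rt i (word s n))%:~R +
      -1 * (M s * drift Rt (urn_frac K (urn_path Rt u0 (word s) n)) 0 i)).
    by apply/funext => s; rewrite /xi; ring.
  rewrite fexpD fexpZ fexp_cond ?mulN1r ?subrr// => s s'.
  exact: urn_mart_history.
rewrite !fexpD fexpZ Mxi mulr0 add0r mulrSr; apply: lerD; first exact/IHn/ltnW.
rewrite -[leRHS]fexp_cst; apply: ler_fexp => s.
exact: (urn_mart_step_le Rt_ge0 Rt_sum).
Qed.

Lemma fexp_mart_norm n : (n <= N.+1)%N ->
  fexp (fun s => l1norm (urn_mart K Rt u0 (word s) n)) <=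
  (sigma * Num.sqrt n%:R) *+ d.
Proof.
move=> nN; rewrite /l1norm fexp_sum -[in leRHS](card_ord d) -sumr_const.
apply: ler_sum => i _; rewrite -ler_sqr ?nnegrE; last 2 first.
- by apply: sumr_ge0 => s _; rewrite mulr_ge0// (urn_law_ge0 p_law).
- by rewrite mulr_ge0 ?sqrtr_ge0// ltW.
rewrite exprMn sqr_sqrtr// mulr_natr; apply: le_trans (fexp_mart_sqr i nN).
exact: sqr_fexp_norm.
Qed.

End FiniteLaw.

(** * The law of the draws of an urn *)

Section UrnLaw.
Context (K : realType) (dT : measure_display) (T : measurableType dT)
  (P : probability T K).

Lemma prob_finite_fibers (I : finType) (Y : T -> I) (Q : pred I) :
  (forall i, measurable [set w | Y w = i]) ->
  P [set w | Q (Y w)] = (\sum_(i | Q i) fine (P [set w | Y w = i]))%:E.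
Proof.
move=> Ym; pose F i := [set w | Y w = i /\ Q i].
have FE i : F i = if Q i then [set w | Y w = i] else set0.
  by apply/seteqP; rewrite /F; case: (Q i); split=> w //= -[].
have -> : [set w | Q (Y w)] = \bigcup_(i in [set` index_enum I]) F i.
  apply/seteqP; split=> [w /= Qw|w [i _ [/= <-]]//].
  by exists (Y w); rewrite /= ?mem_index_enum.
rewrite measure_fin_bigcup//=; last 2 first.
- by move=> i j _ _ [w [[/= <- _] [/= <- _]]].
- by move=> i _; rewrite FE; case: ifP.
rewrite -fsbig_seq ?index_enum_uniq// [in RHS]big_mkcond -sumEFin; apply: eq_bigr => i _.
by rewrite FE; case: ifP => _; rewrite ?measure0// fineK// fin_num_measure.
Qed.

Context (d m : nat) (Rt : tensor d m) (sigma : K) (u0 : 'rV[nat]_d)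
  (U : nat -> T -> 'rV[nat]_d) (C : nat -> 'I_m -> T -> 'I_d).
Hypothesis Rt_ge0 : forall i j, 0 <= Rt i j.
Hypothesis UC : urn_with_draws P Rt u0 U C.
Context (N : nat).

(** The words drawn up to time [N] along the outcome [w]. *)
Definition draws (w : T) : {ffun 'I_N.+1 -> {ffun 'I_m -> 'I_d}} :=
  [ffun k : 'I_N.+1 => [ffun l => C k l w]].

Lemma word_draws w n : (n <= N)%N -> word (draws w) n = [ffun l => C n l w].
Proof. by move=> nN; rewrite /word ffunE inordK. Qed.

Lemma urn_path_draws w n : (n <= N.+1)%N ->
  U n w = urn_path Rt u0 (word (draws w)) n.
Proof.
elim: n => [_|n IHn nN]; first exact: (urn_init UC).
apply/rowP => i; apply/eqP; rewrite urn_pathS -(IHn (ltnW nN)) word_draws//.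
by rewrite -eqz_nat (urn_step UC) PoszD gez0_abs.
Qed.

Lemma draws_measurable s : measurable [set w | draws w = s].
Proof.
have -> : [set w | draws w = s] =
    \bigcap_(k in [set: 'I_N.+1]) \bigcap_(l in [set: 'I_m])
      [set w | C k l w = s k l].
  apply/seteqP; split=> [w /= <- k _ l _ /=|w h]; first by rewrite !ffunE.
  by apply/ffunP => k; apply/ffunP => l; rewrite !ffunE; exact: h.
apply: fin_bigcap_measurable => // k _; apply: fin_bigcap_measurable => // l _.
exact: (urn_draw_measurable UC).
Qed.

(** The probability mass function of [draws]. *)
Definition draws_law (s : {ffun 'I_N.+1 -> {ffun 'I_m -> 'I_d}}) : K :=
  fine (P [set w | draws w = s]).

Lemma draws_lawE (Q : pred {ffun 'I_N.+1 -> {ffun 'I_m -> 'I_d}}) :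
  P [set w | Q (draws w)] = (\sum_(s | Q s) draws_law s)%:E.
Proof. exact: (prob_finite_fibers _ draws_measurable). Qed.

Lemma draws_urn_law : urn_law Rt u0 draws_law.
Proof.
have law_ge0 s : 0 <= draws_law s by rewrite fine_ge0.
split => //.
  apply: EFin_inj; rewrite -(draws_lawE predT) -(probability_setT P).
  by congr (P _); apply/seteqP.
move=> n s j nN.
pose h k := urn_path Rt u0 (word s) k.
have histE : [set w | same_history Rt u0 n s (draws w)] = history U n h.
  apply/seteqP; split=> w /=.
    move=> /same_historyP H k kn; rewrite urn_path_draws ?H//.
    by rewrite (leq_trans kn)// ltnW.
  move=> H; apply/same_historyP => k kn; rewrite -[RHS]H// urn_path_draws//.
  by rewrite (leq_trans kn)// ltnW.
have drawE : [set w | same_history Rt u0 n s (draws w) && (word (draws w) n == j)]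
    = [set w | forall l, C n l w = j l] `&` history U n h.
  rewrite -histE; apply/seteqP; split=> w /=.
    move=> /andP[H /eqP]; rewrite word_draws// => jE; split => // l.
    by rewrite -jE ffunE.
  move=> [jE H]; rewrite H /= word_draws//; apply/eqP/ffunP => l.
  by rewrite ffunE.
have := draws_lawE (fun s' => same_history Rt u0 n s s' && (word s' n == j)).
have := draws_lawE (fun s' => same_history Rt u0 n s s').
rewrite drawE histE.
set ph := \sum_(s' | _) _; set pj := \sum_(s' | _) _ => Ph Pj.
(* the conditional laws say nothing about trajectories of probability zero *)
have [ph0|ph0] := eqVneq ph 0.
  rewrite ph0 mul0r; apply/eqP; rewrite eq_le sumr_ge0// andbT -ph0.
  rewrite /pj /ph (bigID (fun s' => word s' n == j) (same_history _ _ _ _))/=.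
  by rewrite lerDl sumr_ge0.
have Pn0 : P (history U n h) != 0%E by rewrite Ph eqe.
have := urn_draw_indep UC Pn0 j.
rewrite {1}/cond_prob Pj Ph /= => /(canRL (mulfVK ph0)) ->; rewrite mulrC.
congr (_ * _); apply: eq_bigr => l _.
rewrite (urn_draw_law UC Pn0) l1norm_natrV /urn_frac mxE natrVE.
exact: mulrC.
Qed.

End UrnLaw.

(** * Convergence in mean and in probability *)

Lemma cvg_sqrt_div_size (K : realType) (s sigma : K) (d : nat) :
  0 < s -> 0 < sigma ->
  (sigma * Num.sqrt n%:R) *+ d / (s + sigma *+ n) @[n --> \oo] --> (0 : K).
Proof.
move=> s0 sg0.
have sq0 : Num.sqrt (n%:R^-1 : K) *+ d @[n --> \oo] --> (0 : K).
  rewrite -(mul0rn K d); apply: cvgMn.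
  rewrite -(sqrtr0 K); apply: continuous_cvg; first exact: sqrt_continuous.
  by rewrite -cvg_shiftS; exact: cvg_harmonic.
apply: (squeeze_cvgr _ (cvg_cst 0) sq0); apply: nearW => n.
have S0 : 0 < s + sigma *+ n by rewrite ltr_pwDl// mulrn_wge0// ltW.
rewrite divr_ge0 ?mulrn_wge0 ?mulr_ge0 ?sqrtr_ge0 ?(ltW sg0) ?(ltW S0)//=.
rewrite mulrnAl lerMn2r; apply/orP; right.
rewrite ler_pdivrMr//.
(* at [n = 0] both sides are zero, as the inverse of zero is zero *)
case: n S0 => [|n] S0; first by rewrite sqrtr0 mulr0 mulr_ge0// ?sqrtr_ge0// ltW.
rewrite sqrtrV ?ler0n// mulrC ler_pdivlMl ?sqrtr_gt0//.
by rewrite mulrA -expr2 sqr_sqrtr ?ler0n// mulr_natl lerDr ltW.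
Qed.

Section Convergence.
Context (K : realType) (d m : nat) (Rt : tensor d m) (sigma L : K)
  (u0 : 'rV[nat]_d) (xs : 'rV[K]_d).
Hypothesis Rt_ge0 : forall i j, 0 <= Rt i j.
Hypothesis Rt_sum : forall j, \sum_(i < d) ((Rt i j)%:~R : K) = sigma.
Hypothesis sigma_gt0 : 0 < sigma.
Hypothesis u0_gt0 : 0 < l1norm (natrV K u0).
Hypothesis L_lt : L < sigma.
Hypothesis L_ge0 : 0 <= L.
Hypothesis drift_lip : forall x y : 'rV[K]_d, simplex x -> simplex y ->
  l1norm (drift Rt x - drift Rt y) <= L * l1norm (x - y).
Hypothesis xs_simplex : simplex xs.
Hypothesis xs_fixed : drift Rt xs = sigma *: xs.

Local Notation size n := (urn_size sigma u0 n).

(** Bounds, free of the horizon, on the mean sizes of the martingale part and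
    of the rest of the deviation, both divided by the size of the urn. *)
Definition mart_bound (n : nat) : K := (sigma * Num.sqrt n%:R) *+ d / size n.

Fixpoint dev_bound (n : nat) : K :=
  if n is k.+1 then
    (1 - (sigma - L) / size k.+1) * dev_bound k +
    (sigma - L) / size k.+1 * (L / (sigma - L) * mart_bound k)
  else l1norm (size 0 *: (urn_frac K u0 - xs)) / size 0.

Lemma step_in01 n : 0 <= (sigma - L) / size n.+1 <= 1.
Proof.
have S1 := urn_size_gt0 sigma_gt0 u0_gt0 n.+1.
have S0 := urn_size_gt0 sigma_gt0 u0_gt0 n.
rewrite divr_ge0 ?subr_ge0 ?(ltW L_lt) ?(ltW S1)//= ler_pdivrMr// mul1r.
by rewrite urn_sizeS; move: S0 L_ge0; lra.
Qed.

Lemma mart_bound_ge0 n : 0 <= mart_bound n.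
Proof.
rewrite divr_ge0 ?mulrn_wge0 ?mulr_ge0 ?sqrtr_ge0 ?(ltW sigma_gt0)//.
exact/ltW/urn_size_gt0.
Qed.

Lemma dev_bound_ge0 n : 0 <= dev_bound n.
Proof.
elim: n => [|n IHn] /=.
  by rewrite divr_ge0 ?l1norm_ge0//; exact/ltW/urn_size_gt0.
case/andP: (step_in01 n) => c0 c1.
rewrite addr_ge0// mulr_ge0// ?subr_ge0// mulr_ge0 ?mart_bound_ge0//.
by rewrite divr_ge0// subr_ge0 ltW.
Qed.

Lemma cvg_mart_bound : mart_bound @ \oo --> (0 : K).
Proof. exact: cvg_sqrt_div_size. Qed.

Lemma cvg_dev_bound : dev_bound @ \oo --> (0 : K).
Proof.
apply: (@averaging_cvg0 _ _ (fun n => (sigma - L) / size n.+1)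
  (fun n => L / (sigma - L) * mart_bound n)) => //.
- exact: step_in01.
- by apply: arithmetic_inv_unbounded => //; rewrite subr_gt0.
- exact: dev_bound_ge0.
- rewrite -(mulr0 (L / (sigma - L))).
  by apply: cvgM; [exact: cvg_cst|exact: cvg_mart_bound].
Qed.

Context (N : nat) (p : {ffun 'I_N.+1 -> {ffun 'I_m -> 'I_d}} -> K).
Hypothesis p_law : urn_law Rt u0 p.

Lemma fexp_mart_le n : (n <= N.+1)%N ->
  fexp p (fun s => l1norm (urn_mart K Rt u0 (word s) n) / size n) <=
  mart_bound n.
Proof.
move=> nN; have S0 := urn_size_gt0 sigma_gt0 u0_gt0 n.
have -> : fexp p (fun s => l1norm (urn_mart K Rt u0 (word s) n) / size n) =
    fexp p (fun s => l1norm (urn_mart K Rt u0 (word s) n)) / size n.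
  by rewrite /fexp mulr_suml; apply: eq_bigr => s _; rewrite mulrA.
rewrite ler_wpM2r// ?invr_ge0 ?(ltW S0)//.
exact: (fexp_mart_norm Rt_ge0 Rt_sum).
Qed.

Lemma fexp_dev_le n : (n <= N.+1)%N ->
  fexp p (fun s => l1norm (urn_dev Rt sigma u0 xs (word s) n) / size n) <=
  dev_bound n.
Proof.
elim: n => [_|n IHn nN].
  rewrite -[leRHS](fexp_cst p_law); apply: (ler_fexp p_law) => s.
  by rewrite /urn_dev /urn_mart big_ord0 /= subrr !subr0.
have := IHn (ltnW nN); have := fexp_mart_le (ltnW nN) => le1 le2.
case/andP: (step_in01 n) => c0 c1.
apply: le_trans.
  apply: (ler_fexp p_law) => s.
  exact: (urn_dev_le Rt_ge0 Rt_sum sigma_gt0 u0_gt0 xs_simplex xs_fixed L_lt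
    L_ge0 drift_lip).
rewrite fexpD !fexpZ /=; apply: lerD.
  by rewrite ler_wpM2l// subr_ge0.
by rewrite ler_wpM2l// ler_wpM2l// divr_ge0// subr_ge0 ltW.
Qed.

(** Markov's inequality for the distance to [xs]. *)
Lemma prob_dist_le n eps : (n <= N.+1)%N -> 0 < eps ->
  \sum_(s | eps <= l1norm (urn_frac K (urn_path Rt u0 (word s) n) - xs)) p s <=
  (dev_bound n + mart_bound n) / eps.
Proof.
move=> nN eps0; rewrite ler_pdivlMr//.
apply: le_trans (lerD (fexp_dev_le nN) (fexp_mart_le nN)).
rewrite -fexpD mulr_suml big_mkcond; apply: ler_sum => s _.
have p0 := urn_law_ge0 p_law s.
have := urn_frac_dist Rt sigma_gt0 u0_gt0 xs (word s) n => le1.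
case: ifPn => [le2|_]; first by rewrite ler_wpM2l// (le_trans le2).
by rewrite mulr_ge0// (le_trans _ le1)// l1norm_ge0.
Qed.

End Convergence.

(** * Convergence of the composition of the urn *)

Theorem theorem4p2 (K : realType) (dT : measure_display)
    (T : measurableType dT) (P : probability T K)
    (d m : nat) (hd : (1 <= d)%N) (hm : (2 <= m)%N)
    (Rt : tensor d m)
    (hT : forall (i : 'I_d) (j : {ffun 'I_m -> 'I_d}), 0 <= Rt i j)
    (sigma : K) (sigma_gt0 : 0 < sigma)
    (hB : forall j : {ffun 'I_m -> 'I_d},
       \sum_(i < d) ((Rt i j)%:~R : K) = sigma)
    (hE : \big[Num.max/0]_(j : {ffun 'I_m -> 'I_d})
            \big[Num.max/0]_(j' : {ffun 'I_m -> 'I_d})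
              \sum_(i < d) `|((Rt i j)%:~R : K) - (Rt i j')%:~R|
          < 2 * sigma / m%:R)
    (u0 : 'rV[nat]_d) (hu0 : 0 < l1norm (natrV K u0))
    (U : nat -> T -> 'rV[nat]_d) (hU : polya_urn P Rt u0 U) :
  exists xs : 'rV[K]_d,
    unique (fun x : 'rV[K]_d =>
      simplex x /\ sigma *: x = tensor_map Rt (fun=> x)) xs /\
    cvg_in_probability P
      (fun n w => (\sum_(i < d) (U n w 0 i)%:R)^-1 *: natrV K (U n w)) xs.
Proof.
set M := \big[_/_]_j _ in hE.
have M_diam j j' : \sum_(i < d) `|((Rt i j)%:~R : K) - (Rt i j')%:~R| <= M.
  by apply: le_trans (le_bigmax _ _ j); exact: le_trans (le_bigmax _ _ j').
have m0 : 0 < m%:R :> K by rewrite ltr0n (leq_trans _ hm).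
pose L := M * m%:R / 2.
have L_lt : L < sigma.
  by move: hE; rewrite ltr_pdivlMr// /L; lra.
have L_ge0 : 0 <= L.
  by rewrite /L divr_ge0// mulr_ge0 ?(ltW m0)// bigmax_ge_id.
have lip (x y : 'rV[K]_d) : simplex x -> simplex y ->
    l1norm (drift Rt x - drift Rt y) <= L * l1norm (x - y).
  exact: drift_lipschitz.
have sg0 : sigma != 0 by rewrite gt_eqF.
pose F (x : 'rV[K]_d) := sigma^-1 *: drift Rt x.
have FE x : (F x = x) <-> (drift Rt x = sigma *: x).
  rewrite /F; split=> [e|->]; first by rewrite -[in RHS]e scalerA divff// scale1r.
  by rewrite scalerA mulVf// scale1r.
have F_simplex x : simplex x -> simplex (F x).
  move=> sx; apply/simplexP; split=> [i|].
    by rewrite mxE mulr_ge0 ?invr_ge0 ?(ltW sigma_gt0)// drift_ge0.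
  under eq_bigr do rewrite mxE.
  by rewrite -mulr_sumr (drift_sum hB sx) mulVf.
have q_ge0 : 0 <= L / sigma by rewrite divr_ge0// ltW.
have q_lt1 : L / sigma < 1 by rewrite ltr_pdivrMr// mul1r.
have F_contract x y : simplex x -> simplex y ->
    l1norm (F x - F y) <= L / sigma * l1norm (x - y).
  move=> sx sy; rewrite -scalerBr l1normZ gtr0_norm ?invr_gt0//.
  by rewrite [L / _]mulrC -mulrA ler_wpM2l ?invr_ge0 ?(ltW sigma_gt0)// lip.
have sx0 : simplex (urn_frac K u0).
  (* the urn needs a word to move, but its initial composition does not depend
     on it *)
  exact: (urn_frac_simplex hT hB sigma_gt0 hu0
    (fun=> [ffun=> Ordinal hd]) 0).
have [xs sxs /FE xs_fixed] := l1_contraction_fixed q_ge0 q_lt1 F_simplex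
  F_contract sx0.
exists xs; split.
  split=> [|x [sx xE]]; first by split.
  by apply: (l1_contraction_fixed_unique q_lt1 F_contract) => //; exact/FE.
move=> eps eps0; have [C UC] := hU.
pose b n : K := dev_bound sigma L u0 xs n + mart_bound sigma u0 n.
have b0 : b n / eps @[n --> \oo] --> (0 : K).
  rewrite -(mul0r eps^-1); apply: cvgM; last exact: cvg_cst.
  rewrite -(addr0 0); apply: cvgD.
    exact: cvg_dev_bound.
  exact: cvg_mart_bound.
have bE : (b n / eps)%:E @[n --> \oo] --> 0%E.
  by apply: cvg_EFin; [exact: nearW|exact: b0].
apply: (squeeze_cvge _ (cvg_cst 0%E) bE).
apply: nearW => n /=; rewrite measure_ge0 /=.
have -> : [set w | eps <= l1norm ((\sum_(i < d) (U n w 0 i)%:R)^-1 *: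
      natrV K (U n w) - xs)] =
    [set w | eps <= l1norm (urn_frac K
      (urn_path Rt u0 (word (draws C n w)) n) - xs)].
  by apply/seteqP; split=> w /=; rewrite (urn_path_draws hT UC w (leqnSn n)).
rewrite (draws_lawE UC (fun s => eps <= l1norm (urn_frac K
      (urn_path Rt u0 (word s) n) - xs))) lee_fin.
by apply: prob_dist_le => //; exact: (draws_urn_law hT UC).
Qed.
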